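(* Let $b \geq 2$ and $s \geq 2$ be integers and let $m \geq 2s^s(s-1)^s$ be an integer. Then there is a set $\Gamma \subseteq [0,1)^s$ with the following two properties: (i) for every $\boldsymbol{x} \in [0,1)^s$ there exists $\boldsymbol{\gamma} \in \Gamma$ with \[ \| \boldsymbol{x} - \boldsymbol{\gamma} \| < b\sqrt{s}\, \frac{1}{b^{ \frac{m}{2(s-1)s}}}, \] where $\|\cdot\|$ is the Euclidean norm; (ii) if $\mathcal{P} = \{ \boldsymbol{x}_0, \ldots, \boldsymbol{x}_{b^m -1} \}$ is a $(0,m,s)$-net in base $b$ and $\boldsymbol{x}_i \in \Gamma$ for some $i \in \{ 0, \ldots, b^m-1 \}$, then, with $N=b^m$, \[ D^{*}(\mathcal{P}) \geq \frac{(b-1)^s(2s-3)^{s-1}}{b^s\,(4s^2(s-1)^2 \log b)^{s-1}}\, \frac{(\log N)^{s-1}}{N}. \]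
   Context: For integers $b \geq 2$, $s \geq 1$, $m \geq 0$, a $(0,m,s)$-net in base $b$ is a set of $b^m$ points in $[0,1)^s$ such that every interval of the form $\prod_{i=1}^s [a_i b^{-d_i}, (a_i+1) b^{-d_i})$ with $d_i \in \mathbb{N}_0$, $a_i \in \{0,\dots,b^{d_i}-1\}$ and volume $b^{-m}$ contains exactly one point of the set. For an $N$-point set $\mathcal{P} = \{\boldsymbol{x}_0,\dots,\boldsymbol{x}_{N-1}\}$ in $[0,1)^s$ and $\boldsymbol{y}=(y^{(1)},\dots,y^{(s)})$, let $\Delta(\boldsymbol{y},\mathcal{P}) = \sum_{n=0}^{N-1}\big(\chi_{[0,y^{(1)})\times\cdots\times[0,y^{(s)})}(\boldsymbol{x}_n) - y^{(1)}\cdots y^{(s)}\big)$; the star-discrepancy is $D^*(\mathcal{P}) = \sup_{\boldsymbol{y}\in[0,1)^s} |\Delta(\boldsymbol{y},\mathcal{P})|/N$. $\log$ is the natural logarithm. *)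

(* Defs.v *)
From HB Require Import structures.
From mathcomp Require Import all_boot all_order all_algebra.
From mathcomp Require Import all_classical all_reals all_analysis.
Set Implicit Arguments. Unset Strict Implicit. Unset Printing Implicit Defensive.
Import Order.TTheory GRing.Theory Num.Theory.
Local Open Scope ring_scope.
Local Open Scope classical_set_scope.

Section Defs.
Variable R : realType.

Definition in_unit_cube (s : nat) (x : 'I_s -> R) : Prop :=
  forall i, 0 <= x i /\ x i < 1.

Definition euclid_norm (s : nat) (x : 'I_s -> R) : R :=
  Num.sqrt (\sum_(i < s) x i ^+ 2).

Definition in_elem_box (b s : nat) (d a : 'I_s -> nat) (x : 'I_s -> R) : bool :=
  [forall i, ((a i)%:R / (b ^ d i)%:R <= x i) && (x i < (a i).+1%:R / (b ^ d i)%:R)].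

(* An N-point set as an indexed family (x_0, ..., x_{N-1}); a (0,m,s)-net in
   base b: b^m points in [0,1)^s such that every elementary interval of volume
   b^-m (i.e. with sum_i d_i = m) contains exactly one point. *)
Definition is_net (b m s : nat) (P : 'I_(b ^ m) -> ('I_s -> R)) : Prop :=
  (forall n, in_unit_cube (P n)) /\
  forall (d a : 'I_s -> nat),
    (\sum_(i < s) d i)%N = m ->
    (forall i, (a i < b ^ d i)%N) ->
    #|[set n : 'I_(b ^ m) | in_elem_box b d a (P n)]| = 1%N.

Definition local_disc (N s : nat) (P : 'I_N -> ('I_s -> R)) (y : 'I_s -> R) : R :=
  \sum_(n < N)
    ((([forall i, (0 <= P n i) && (P n i < y i)]) : nat)%:R - \prod_(i < s) y i).

Definition star_disc (N s : nat) (P : 'I_N -> ('I_s -> R)) : R :=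
  sup [set `|local_disc P y| / N%:R | y in [set y | in_unit_cube y]].

End Defs.

(* Main.v *)
Require Import Defs.
From HB Require Import structures.
From mathcomp Require Import all_boot all_order all_algebra.
From mathcomp Require Import all_classical all_reals all_analysis.
From mathcomp Require Import zify ring lra.
Import Order.TTheory GRing.Theory Num.Theory.
Local Open Scope ring_scope.
Local Open Scope classical_set_scope.

(* Let the first k digits of each coordinate of a point g of Gamma be free, with
   k = m / (2 s (s - 1)), let all digits from some index M on vanish, where
   (s - 1) M + k <= m, and let the digit with (zero-based) index j, k <= j < M,
   be b - 1 if j is 0 mod s (m mod s for one distinguished coordinate) and 0
   otherwise.  If g belongs to a net, evaluate the local discrepancy at g itself:
   [0, g) splits into boxes indexed by the positions f_1, ..., f_s of one digit
   of each coordinate.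
   If sum f_i + s <= m, the box is a union of elementary boxes, and its local
   discrepancy is 0.  If sum f_i >= m, it lies in an elementary box of volume
   b^-m containing g, hence contains no point of the net, and its contribution
   is minus b^m times its volume.  In between, one of the digits is 0 by the
   congruences, and the box is empty.  So nothing cancels, and each of the many
   boxes with sum f_i = m and all digits b - 1 contributes -((b - 1) / b)^s. *)

(** * Auxiliary facts on finite sums and indicators *)

(** Raise [e] from 0 one unit at a time: while its sum is below that of [d], some coordinate has
    room. This serves to enclose a fine box in an elementary one of volume b^-m. *)
Lemma le_sum_pointwise {I : finType} (m : nat) (d : I -> nat) :
  (m <= \sum_i d i)%N ->
  exists e : I -> nat, (forall i, e i <= d i)%N /\ (\sum_i e i)%N = m.
Proof.
elim: m => [_|m IHm md]; first by exists (fun=> 0%N); rewrite big1.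
have [e [ed em]] := IHm (ltnW md).
have [i eid] : exists i, (e i < d i)%N.
  apply/existsP; apply: contraLR md => /existsPn h.
  by rewrite -leqNgt -em leq_sum// => i _; rewrite leqNgt h.
exists (fun j => e j + (j == i))%N; split=> [j|].
  by case: eqP => [->|_]; rewrite ?addn1 ?addn0.
by rewrite big_split /= em (bigD1 i)//= eqxx big1 ?addn1// => j /negbTE ->.
Qed.

Lemma homo_leq_steps {R : realType} (u : nat -> R) :
  (forall j, u j <= u j.+1) -> forall i j, (i <= j)%N -> u i <= u j.
Proof. move=> uS i j; apply: (homo_leq (r := fun x y => x <= y)) => // y x z; exact: le_trans. Qed.

Lemma sum_consecutive_intervals {R : realType} (u : nat -> R) (x : R) (M : nat) :
  (forall j, u j <= u j.+1) ->
  \sum_(j < M) ((u j <= x < u j.+1)%R : nat)%:R = (((u 0%N <= x < u M)%R) : nat)%:R :> R.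
Proof.
move=> uS; elim: M => [|M IH]; first by rewrite big_ord0 le_lt_asym.
rewrite big_ord_recr /= IH -natrD; congr _%:R.
have := homo_leq_steps u uS 0 M (leq0n _); have := uS M.
by case: (leP (u 0%N) x); case: (ltP x (u M)); case: (ltP x (u M.+1)) => //= *; exfalso; lra.
Qed.

Lemma natr_forall {R : realType} {I : finType} (p : pred I) :
  (([forall i, p i] : bool) : nat)%:R = \prod_i ((p i : nat)%:R : R).
Proof.
rewrite -natr_prod; congr _%:R.
case: forallP => [h|/existsNP [i /negP/negbTE h]].
  by rewrite big1// => i _; rewrite h.
by rewrite (bigD1 i)//= h mul0n.
Qed.

(** * Counting net points in b-adic boxes *)

Lemma net_elem_box {R : realType} {b m s : nat} {P : 'I_(b ^ m) -> 'I_s -> R}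
    (d a : 'I_s -> nat) :
  is_net P -> (\sum_i d i)%N = m -> (forall i, a i < b ^ d i)%N ->
  exists2 n0, in_elem_box b d a (P n0) &
    forall n, in_elem_box b d a (P n) = (n == n0).
Proof.
move=> [_ netP] dm ab.
have /eqP := netP d a dm ab.
rewrite -(@eq_card _ [pred n | in_elem_box b d a (P n)]); last first.
  by move=> n; rewrite !inE; apply/idP/idP; rewrite ?inE.
move=> /fintype.card1P [n0 h]; exists n0; first by have := h n0; rewrite !inE eqxx.
by move=> n; have := h n; rewrite !inE.
Qed.

(** Each side splits into [w i] adjacent cells of length b^-(d i), so distributing the product over
    the sums leaves one elementary box, hence one point, per choice of cells. *)
Lemma net_box_sum_eq {R : realType} {b m s : nat} {P : 'I_(b ^ m) -> 'I_s -> R}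
    (d lo w : 'I_s -> nat) :
  (0 < b)%N -> is_net P -> (\sum_i d i)%N = m -> (forall i, lo i + w i <= b ^ d i)%N ->
  \sum_n \prod_i (((lo i)%:R / (b ^ d i)%:R <= P n i
    < (lo i + w i)%N%:R / (b ^ d i)%:R)%R : nat)%:R
  = \prod_i (w i)%:R :> R.
Proof.
(* A common bound on the widths lets the sums over the sides share the index type ['I_B]. *)
move=> b0 netP dm lob; set B := (\sum_i w i)%N.
have wB i : (w i <= B)%N by rewrite /B (bigD1 i)//= leq_addr.
pose F n i (c : nat) : R := (((lo i + c)%N%:R / (b ^ d i)%:R <= P n i
    < (lo i + c).+1%:R / (b ^ d i)%:R)%R : nat)%:R.
have box n i : (((lo i)%:R / (b ^ d i)%:R <= P n i
    < (lo i + w i)%N%:R / (b ^ d i)%:R)%R : nat)%:R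
    = \sum_(c < B | (c < w i)%N) F n i c :> R.
  rewrite -(@big_ord_widen _ _ _ _ _ (F n i))//.
  have := @sum_consecutive_intervals R (fun c => (lo i + c)%N%:R / (b ^ d i)%:R)
    (P n i) (w i).
  rewrite addn0 => <-; last first.
    by move=> j; rewrite ler_wpM2r ?invr_ge0 ?ler0n// ler_nat leq_add2l.
  by apply: eq_bigr => c _; rewrite addnS.
rewrite (eq_bigr _ (fun n _ => eq_bigr _ (fun i _ => box n i))).
rewrite (eq_bigr _ (fun n _ => bigA_distr_big_dep _ _)) exchange_big /=.
transitivity (\sum_(f in family (fun i => [pred c : 'I_B | (c < w i)%N])) (1 : R)).
  apply: eq_bigr => f /familyP fw.
  have [i|n0 _ h] := net_elem_box d (fun i => lo i + f i)%N netP dm.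
    have fwi : (f i < w i)%N := fw i; have := lob i; lia.
  rewrite (bigD1 n0)//= [X in _ + X]big1 ?addr0 => [|n nn0].
    by rewrite /F -natr_forall -/(in_elem_box b d (fun i => lo i + f i)%N (P n0)) h eqxx.
  by rewrite /F -natr_forall -/(in_elem_box b d (fun i => lo i + f i)%N (P n)) h (negbTE nn0).
rewrite sumr_const card_family -natr_prod foldrE big_map enumT.
congr _%:R; apply: eq_bigr => i _.
rewrite -sum1_card -(big_ord_widen B (fun=> 1%N)) ?wB//.
by rewrite sum1_card card_ord.
Qed.

(** Refining the first coordinate by the missing [m - \sum_i d i] digits brings the total order to
    exactly [m], the case of [net_box_sum_eq]. *)
Lemma net_box_sum {R : realType} {b m s : nat} {P : 'I_(b ^ m) -> 'I_s -> R}
    (d lo w : 'I_s -> nat) :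
  (0 < s)%N -> (0 < b)%N -> is_net P -> (\sum_i d i <= m)%N ->
  (forall i, lo i + w i <= b ^ d i)%N ->
  \sum_n \prod_i (((lo i)%:R / (b ^ d i)%:R <= P n i
    < (lo i + w i)%N%:R / (b ^ d i)%:R)%R : nat)%:R
  = (b ^ m)%:R * \prod_i ((w i)%:R / (b ^ d i)%:R) :> R.
Proof.
case: s P d lo w => // s P d lo w _ b0 netP dm lob.
pose e (i : 'I_s.+1) := if i == ord0 then (m - \sum_i d i)%N else 0%N.
have em : (\sum_i (d i + e i))%N = m.
  rewrite big_split /= [X in (_ + X)%N](bigD1 ord0)//= /e eqxx.
  by rewrite [X in (_ + (_ + X))%N]big1 ?addn0 ?subnKC// => i /negbTE ->.
have be i : (b ^ e i)%:R != 0 :> R by rewrite pnatr_eq0 -lt0n expn_gt0 b0.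
have bd i : (b ^ d i)%:R != 0 :> R by rewrite pnatr_eq0 -lt0n expn_gt0 b0.
have scale i k : (k * b ^ e i)%N%:R / (b ^ (d i + e i))%:R = k%:R / (b ^ d i)%:R :> R.
  by rewrite expnD !natrM invfM mulrACA divff ?mulr1.
transitivity (\sum_n \prod_i ((((lo i * b ^ e i)%N%:R / (b ^ (d i + e i))%:R <= P n i
    < (lo i * b ^ e i + w i * b ^ e i)%N%:R / (b ^ (d i + e i))%:R)%R : nat)%:R) : R).
  by apply: eq_bigr => n _; apply: eq_bigr => i _; rewrite -mulnDl !scale.
rewrite (net_box_sum_eq (fun i => d i + e i)%N (fun i => lo i * b ^ e i)%N
  (fun i => w i * b ^ e i)%N)//; last first.
  by move=> i; rewrite -mulnDl expnD leq_mul2r lob orbT.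
rewrite -[in (b ^ m)%N]em expn_sum natr_prod -big_split /=; apply: eq_bigr => i _.
by rewrite expnD !natrM; field.
Qed.

(** * Base-b digit strings and their truncations *)

(** For digits below [b], the integer written [D 0], ..., [D (j-1)] in base [b], with [D 0] the most
    significant digit. *)
Fixpoint prefix (b : nat) (D : nat -> nat) (j : nat) : nat :=
  if j is j'.+1 then (b * prefix b D j' + D j')%N else 0%N.

Lemma prefix_lt (b : nat) (D : nat -> nat) (j : nat) :
  (forall j, D j < b)%N -> (prefix b D j < b ^ j)%N.
Proof.
move=> Db; elim: j => //= j IH; rewrite expnS.
by have := Db j; have : (b * (prefix b D j).+1 <= b * b ^ j)%N; [rewrite leq_mul2l IH orbT|lia].
Qed.

Lemma prefix_divn (b c k : nat) (D : nat -> nat) :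
  (c < b ^ k)%N -> (forall j, (j < k)%N -> D j = c %/ b ^ (k - j.+1) %% b)%N ->
  forall j, (j <= k)%N -> prefix b D j = (c %/ b ^ (k - j))%N.
Proof.
move=> cb Dc; elim=> [_|j IH jk] /=; first by rewrite subn0 divn_small.
rewrite IH 1?ltnW// Dc//.
have -> : (b ^ (k - j) = b ^ (k - j.+1) * b)%N by rewrite -expnSr -subSn// subSS.
by rewrite divnMA [RHS](divn_eq _ b) mulnC.
Qed.

(** The number with fractional digits [D 0], [D 1], ... in base [b], truncated after [j] digits. *)
Definition cut {R : realType} (b : nat) (D : nat -> nat) (j : nat) : R :=
  (prefix b D j)%:R / (b ^ j)%:R.

Lemma cut0 {R : realType} (b : nat) (D : nat -> nat) : cut b D 0 = 0 :> R.
Proof. by rewrite /cut mul0r. Qed.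

Lemma cut_scale {R : realType} (b : nat) (D : nat -> nat) (j : nat) :
  (0 < b)%N -> cut b D j = (b * prefix b D j)%N%:R / (b ^ j.+1)%:R :> R.
Proof.
move=> b0; have b0' : b%:R != 0 :> R by rewrite pnatr_eq0 -lt0n.
by rewrite /cut expnS !natrM invfM mulrACA divff// mul1r.
Qed.

Lemma cutS {R : realType} (b : nat) (D : nat -> nat) (j : nat) :
  (0 < b)%N -> cut b D j.+1 - cut b D j = (D j)%:R / (b ^ j.+1)%:R :> R.
Proof. by move=> b0; rewrite (cut_scale _ _ j b0) /cut -mulrBl /= natrD addrC addKr. Qed.

Lemma cut_leS {R : realType} (b : nat) (D : nat -> nat) (j : nat) :
  (0 < b)%N -> cut b D j <= cut b D j.+1 :> R.
Proof. by move=> b0; rewrite -subr_ge0 cutS// divr_ge0. Qed.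

Lemma cut_le {R : realType} (b : nat) (D : nat -> nat) (i j : nat) :
  (0 < b)%N -> (i <= j)%N -> cut b D i <= cut b D j :> R.
Proof. by move=> b0; apply: homo_leq_steps => {i j} j; exact: cut_leS. Qed.

(** The digits from position [i] on add less than b^-i. With denominators cleared, induction on [j]
    gives (prefix j + 1) b^i <= (prefix i + 1) b^j. *)
Lemma cut_lt_succ {R : realType} (b : nat) (D : nat -> nat) (i j : nat) :
  (0 < b)%N -> (forall j, D j < b)%N -> (i <= j)%N ->
  cut b D j < (prefix b D i).+1%:R / (b ^ i)%:R :> R.
Proof.
move=> b0 Db ij; have bj k : 0 < (b ^ k)%:R :> R by rewrite ltr0n expn_gt0 b0.
apply: (@lt_le_trans _ _ ((prefix b D j).+1%:R / (b ^ j)%:R)).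
  by rewrite /cut ltr_pM2r ?invr_gt0// ltr_nat.
rewrite ler_pdivrMr// mulrAC ler_pdivlMr// -!natrM ler_nat.
elim: j ij => [|j IH]; first by rewrite leqn0 => /eqP ->.
rewrite leq_eqVlt => /predU1P [->//|/IH {}IH]; rewrite [prefix _ _ j.+1]/= !expnS.
apply: (@leq_trans (b * ((prefix b D j).+1 * b ^ i))%N).
  by rewrite mulnA leq_mul2r; have := Db j; lia.
by rewrite [leqRHS]mulnCA leq_mul2l IH orbT.
Qed.

(** * The local discrepancy at a corner with finite digit expansion *)

(* The anchored box is cut at the digit expansion of its corner: the box indexed
   by [f] has its [i]-th side between the truncations of the corner to [f i] and
   to [f i + 1] digits. *)
Lemma local_disc_expand {R : realType} {b m s : nat} {P : 'I_(b ^ m) -> 'I_s -> R}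
    (D : 'I_s -> nat -> nat) (M : nat) :
  (0 < b)%N -> is_net P ->
  local_disc P (fun i => cut b (D i) M) =
  \sum_(f : {ffun 'I_s -> 'I_M})
    (\sum_n \prod_i (((cut b (D i) (f i) <= P n i < cut b (D i) (f i).+1)%R : nat)%:R)
     - (b ^ m)%:R * \prod_i ((D i (f i))%:R / (b ^ (f i).+1)%:R)).
Proof.
move=> b0 [Pcube _].
have vol : \prod_i cut b (D i) M =
    \sum_(f : {ffun 'I_s -> 'I_M}) \prod_i ((D i (f i))%:R / (b ^ (f i).+1)%:R) :> R.
  rewrite -(bigA_distr_bigA (fun i (j : 'I_M) => (D i j)%:R / (b ^ j.+1)%:R)).
  apply: eq_bigr => i _; rewrite -[LHS]subr0 -[X in _ - X](cut0 b (D i)).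
  rewrite -(telescope_sumr (cut b (D i)) (leq0n M)) big_mkord.
  by apply: eq_bigr => j _; rewrite cutS.
have ind n : (([forall i, (0 <= P n i) && (P n i < cut b (D i) M)]) : nat)%:R =
    \sum_(f : {ffun 'I_s -> 'I_M})
      \prod_i (((cut b (D i) (f i) <= P n i < cut b (D i) (f i).+1)%R : nat)%:R) :> R.
  rewrite natr_forall -(bigA_distr_bigA (fun i (j : 'I_M) =>
    (((cut b (D i) j <= P n i < cut b (D i) j.+1)%R : nat)%:R))).
  apply: eq_bigr => i _; rewrite (sum_consecutive_intervals (cut b (D i))) ?cut0//.
  by move=> j; exact: cut_leS.
rewrite /local_disc sumrB sumrB (eq_bigr _ (fun n _ => ind n)) exchange_big /=.
by rewrite sumr_const card_ord vol -[_ *+ _]mulr_natl mulr_sumr.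
Qed.

(** Side [i] consists of [D i (f i)] cells of order [f i + 1], so the total order is at most [m] and
    [net_box_sum] applies. *)
Lemma net_cut_box_fair {R : realType} {b m s : nat} {P : 'I_(b ^ m) -> 'I_s -> R}
    (D : 'I_s -> nat -> nat) (f : 'I_s -> nat) :
  (0 < s)%N -> (0 < b)%N -> is_net P -> (forall i j, D i j < b)%N ->
  (\sum_i f i + s <= m)%N ->
  \sum_n \prod_i (((cut b (D i) (f i) <= P n i < cut b (D i) (f i).+1)%R : nat)%:R)
  = (b ^ m)%:R * \prod_i ((D i (f i))%:R / (b ^ (f i).+1)%:R) :> R.
Proof.
move=> s0 b0 netP Db fm.
rewrite -(net_box_sum (fun i => (f i).+1) (fun i => b * prefix b (D i) (f i))%N
  (fun i => D i (f i)) s0 b0 netP); last 2 first.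
- under eq_bigr do rewrite -addn1.
  by rewrite big_split /= sum_nat_const card_ord muln1.
- by move=> i; exact: ltnW (prefix_lt b (D i) (f i).+1 (Db i)).
by apply: eq_bigr => n _; apply: eq_bigr => i _; rewrite cut_scale.
Qed.

(** Shortening the digit strings to total length [m] encloses the box in an elementary interval that
    also contains the corner [P n0]. The corner is then its only net point, and it lies outside the
    box. *)
Lemma net_cut_box_empty {R : realType} {b m s : nat} {P : 'I_(b ^ m) -> 'I_s -> R}
    (D : 'I_s -> nat -> nat) (M : nat) (f : 'I_s -> nat) (n0 : 'I_(b ^ m)) :
  (0 < s)%N -> (0 < b)%N -> is_net P -> (forall i j, D i j < b)%N ->
  (forall i, f i < M)%N -> (forall i, P n0 i = cut b (D i) M) ->
  (m <= \sum_i f i)%N ->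
  \sum_n \prod_i (((cut b (D i) (f i) <= P n i < cut b (D i) (f i).+1)%R : nat)%:R)
  = 0 :> R.
Proof.
move=> s0 b0 netP Db fM Pn0 mf; apply: big1 => n _.
rewrite -natr_forall; case: forallP => //= inb; exfalso.
have [e [ef em]] := le_sum_pointwise m f mf.
have [//|n1 _ h] := net_elem_box e (fun i => prefix b (D i) (e i)) netP em.
  by move=> i; exact: prefix_lt.
have En : n = n1.
  apply/eqP; rewrite -h; apply/forallP => i.
  have /andP[lo hi] := inb i; apply/andP; split.
    by apply: le_trans lo; exact: cut_le.
  by apply: lt_trans hi _; apply: cut_lt_succ => //; rewrite leqW.
have En0 : n0 = n1.
  apply/eqP; rewrite -h; apply/forallP => i; rewrite Pn0; apply/andP; split.
    by apply: cut_le => //; apply: leq_trans (ef i) (ltnW (fM i)).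
  by apply: cut_lt_succ => //; apply: leq_trans (ef i) (ltnW (fM i)).
(* As [f i + 1 <= M], the half-open side ends at or below the corner and excludes it. *)
have /andP[_] := inb (Ordinal s0).
by rewrite En -En0 Pn0 ltNge cut_le.
Qed.

(** Every term of the expansion is nonpositive, so the terms outside [S] may be dropped from an
    upper bound, while those in [S] are known exactly. *)
Lemma local_disc_le {R : realType} {b m s : nat} {P : 'I_(b ^ m) -> 'I_s -> R}
    (D : 'I_s -> nat -> nat) (M : nat) (n0 : 'I_(b ^ m))
    (S : {set {ffun 'I_s -> 'I_M}}) :
  (0 < s)%N -> (0 < b)%N -> is_net P -> (forall i j, D i j < b)%N ->
  (forall i, P n0 i = cut b (D i) M) ->
  (forall f : 'I_s -> nat, (forall i, f i < M)%N -> (m < \sum_i f i + s)%N ->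
     (\sum_i f i < m)%N -> exists i, D i (f i) = 0%N) ->
  (forall f, f \in S -> (\sum_i f i)%N = m /\ forall i, D i (f i) = b.-1) ->
  local_disc P (fun i => cut b (D i) M) <= - (#|S|%:R * ((b%:R - 1) / b%:R) ^+ s).
Proof.
move=> s0 b0 netP Db Pn0 gap inS.
have b0' : b%:R != 0 :> R by rewrite pnatr_eq0 -lt0n.
rewrite (local_disc_expand D M b0 netP) (bigID (mem S))/=.
rewrite -[leRHS]addr0; apply: lerD.
  rewrite mulr_natl -mulNrn -sumr_const; apply: ler_sum => f /inS[fm Df].
  rewrite (net_cut_box_empty D M (fun i => f i) n0)// ?fm// sub0r lerN2.
  (* Spreading b^m as the product of the b^(f i) leaves a factor (b - 1) / b per coordinate. *)
  rewrite -[in (b ^ m)%N]fm expn_sum natr_prod -big_split /= le_eqVlt.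
  apply/orP; left; rewrite -[X in _ ^+ X]card_ord -prodr_const; apply/eqP/eq_bigr => i _.
  have bf : (b ^ f i)%:R != 0 :> R by rewrite pnatr_eq0 -lt0n expn_gt0 b0.
  by rewrite Df -subn1 natrB// expnSr natrM invfM mulrCA mulVKf.
apply: sumr_le0 => f _.
have [fm|fm] := leqP (\sum_i f i + s)%N m.
  by rewrite (net_cut_box_fair D (fun i => f i))// subrr.
have [mf|fm'] := leqP m (\sum_i f i)%N.
  by rewrite (net_cut_box_empty D M (fun i => f i) n0)// sub0r oppr_le0 mulr_ge0// prodr_ge0// => i _; rewrite divr_ge0.
have [//|i Dfi] := gap (fun i => f i) _ fm fm'.
(* A zero digit makes side [i] degenerate: the volume is 0 and no point lies in the box. *)
rewrite [X in _ - _ * X](bigD1 i)//= Dfi mul0r mul0r mulr0 subr0.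
rewrite big1// => n _; rewrite (bigD1 i)//=.
have -> : cut b (D i) (f i).+1 = cut b (D i) (f i) :> R.
  by apply/eqP; rewrite -subr_eq0 cutS// Dfi mul0r.
by rewrite le_lt_asym mul0r.
Qed.

Lemma le_star_disc {R : realType} {N s : nat} (P : 'I_N -> 'I_s -> R) (y : 'I_s -> R) :
  in_unit_cube y -> `|local_disc P y| / N%:R <= star_disc P.
Proof.
move=> ycube; apply: ub_le_sup; last by exists y.
(* [sup] dominates its set once that set is bounded above; here each summand of [local_disc] lies in
   [-1, 1]. *)
exists 1 => _ [z zcube <-].
have [N0|N0] := eqVneq (N%:R : R) 0; first by rewrite N0 invr0 mulr0.
have Npos : 0 < N%:R :> R by rewrite lt0r N0 ler0n.
rewrite ler_pdivrMr// mul1r.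
apply: le_trans (ler_norm_sum _ _ _) _.
rewrite -[leRHS](_ : \sum_(n < N) 1 = _); last by rewrite sumr_const card_ord.
apply: ler_sum => n _.
have z0 : 0 <= \prod_i z i by apply: prodr_ge0 => i _; case: (zcube i).
have z1 : \prod_i z i <= 1.
  by apply: prodr_ile1 => i _; have [-> /ltW ->] := zcube i.
by case: [forall _, _] => /=; rewrite ler_norml; lra.
Qed.

(** * Choice and count of digit positions *)

(** Some [f i < k] would force the sum of all [f j + 1] to be at most [n * M + k <= m]. If moreover
    all congruences held, [m - \sum_i f i] would be a multiple of [n + 1] strictly between 0 and
    [n + 1]. *)
Lemma digit_sum_gap {n k m M : nat} (f : 'I_n.+1 -> nat) (r : 'I_n.+1 -> nat) :
  (n * M + k <= m)%N -> (forall i, f i < M)%N -> (\sum_i r i)%N = m ->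
  (m < \sum_i f i + n.+1)%N -> (\sum_i f i < m)%N ->
  exists i, (k <= f i)%N && (f i != r i %[mod n.+1]).
Proof.
move=> Mm fM rm lo hi; apply/existsP; apply: contraLR hi => /existsPn h.
rewrite -leqNgt.
have fk i : (k <= f i)%N.
  rewrite leqNgt; apply/negP => fik.
  have : (\sum_(j | j != i) (f j).+1 <= n * M)%N.
    apply: (@leq_trans (\sum_(j | j != i) M)); first by apply: leq_sum.
    by rewrite sum_nat_const cardC1 card_ord.
  have : (\sum_j (f j).+1 = \sum_j f j + n.+1)%N.
    under eq_bigr do rewrite -addn1.
    by rewrite big_split /= sum_nat_const card_ord muln1.
  rewrite (bigD1 i)//=.
  move: (\sum_(j < n.+1 | j != i) _)%N (\sum_(j < n.+1) _)%N lo => ? ? lo. lia.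
have fr : (\sum_i f i = m %[mod n.+1])%N.
  rewrite -rm -modn_summ -[RHS]modn_summ; congr (_ %% _)%N; apply: eq_bigr => i _.
  by apply/eqP; have := h i; rewrite fk /= negbK.
rewrite leqNgt; apply/negP => fm.
have /eqP : (m - \sum_i f i = 0 %[mod n.+1])%N.
  by apply/eqP; rewrite mod0n -[_ == _](eqn_mod_dvd _ (ltnW fm)); apply/eqP.
by rewrite mod0n modn_small; lia.
Qed.

(* With s = n + 1, the multiples (q + h) s with h < K are digit positions in [k, M)
   so large that the last position, forced by the condition that all positions sum
   to m, is still below M. *)
Lemma digit_count_bound (n m : nat) :
  (0 < n)%N -> (2 * n.+1 ^ 2 * n ^ 2 <= m)%N ->
  let k := (m %/ (2 * n * n.+1))%N in
  let M := ((m - k) %/ n)%N in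
  let q := ((m - M) %/ (n.+1 * n)).+1 in
  let K := ((M.-1 %/ n.+1).+1 - q)%N in
  [/\ (k <= M)%N /\ (n * M + k <= m)%N, (k <= q * n.+1)%N, (m < M + q * (n.+1 * n))%N
    & ((2 * n - 1) * m <= 4 * n.+1 ^ 2 * n ^ 2 * K)%N].
Proof.
move=> n0 mn k M q K.
have km : (k * (2 * n * n.+1) <= m)%N by exact: leq_trunc_div.
have k1 : (k <= m)%N by exact: leq_div.
have Mm : (M * n <= m - k)%N by exact: leq_trunc_div.
have Mm' : (m - k < M.+1 * n)%N by rewrite ltn_ceil.
have M1 : (M <= m)%N by rewrite (leq_trans (leq_div _ _))// leq_subr.
have qm : (q.-1 * (n.+1 * n) <= m - M)%N by exact: leq_trunc_div.
have qm' : (m - M < q * (n.+1 * n))%N by rewrite ltn_ceil// muln_gt0 n0.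
have Kq : (M.-1 < (M.-1 %/ n.+1).+1 * n.+1)%N by rewrite ltn_ceil.
have sK : (M <= n.+1 * K + n.+1 * q)%N.
  rewrite -mulnDr /K; apply: (@leq_trans (n.+1 * (M.-1 %/ n.+1).+1)%N).
    by rewrite mulnC (leq_trans (leqSpred _)).
  by rewrite leq_mul2l addnC -leq_subLR leqnn orbT.
have q1 : (0 < q)%N by [].
clearbody k M q K.
(* This gives [k <= q * n.+1] through [qm']. For [n > 1], both [n * k] and [M] are at most m / 2;
   for [n = 1], [Mm] suffices. *)
have nk : (n * k <= m - M)%N.
  have [n1|n1] := leqP n 1.
    have En : n = 1%N by lia.
    by clear -Mm En k1; subst n; lia.
  have M2 : (M * 2 <= M * n)%N by rewrite leq_mul2l n1 orbT.
  have ks : (n * k <= n * k * n.+1)%N by rewrite leq_pmulr.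
  by clear -M2 ks Mm km; lia.
(* Eliminating [q] here and [M] in [step2] leaves a lower bound for [K] in terms of [m], [k] and
   [n]. *)
have step1 : (n.+1 * M <= n.+1 * n * K + m + n.+1 * n)%N.
  have := leq_mul (leqnn n) sK; case: q q1 qm {qm' sK} => // q _ /=.
  by clear -M1; lia.
have step2 : (m + n.+1 <= n.+1 * n ^ 2 * K + n.+1 * k + n.+1 * n + n.+1 * n ^ 2)%N.
  have := leq_mul (leqnn n) step1; have := leq_mul (leqnn n.+1) Mm'.
  by clear -k1; lia.
split; [split; last by lia| |by clear -qm' M1; lia|].
- have [//|Mk] := leqP k M.
  have := leq_mul Mk (leqnn n).
  have : (k * n.+1 <= k * (2 * n * n.+1))%N by rewrite leq_mul2l leq_pmull ?orbT// muln_gt0.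
  by clear -Mm' km; lia.
- by rewrite -(leq_pmul2r n0); clear -qm' nk; lia.
(* Bounding [k] by [km] leaves the coefficient 2(n+1)(2n-1) = n(2n-1) + (n+2)(2n-1) of [m]. The
   first part is the claim; the second absorbs the constants by [mn] and [poly]. *)
rewrite -(leq_pmul2l n0).
have := leq_mul (leqnn (4 * n.+1 * n)) step2.
have := leq_mul (leqnn 2) (leq_mul (leqnn n.+1) km).
have := leq_mul (leqnn ((n.+2) * (2 * n - 1))) mn.
have poly : (2 * n ^ 2 + 2 * n <= n.+2 * (2 * n - 1) * n + 2)%N.
  clear -n0; case: n n0 => // p _; rewrite (_ : (2 * p.+1 - 1 = (2 * p).+1)%N); last by lia.
  by lia.
have := leq_mul (leqnn (2 * n.+1 ^ 2 * n)) poly.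
have [c Ec] : exists c, n = c.+1 by exists n.-1; rewrite prednK.
rewrite Ec (_ : (2 * c.+1 - 1 = (2 * c).+1)%N); last by clear; lia.
by clear; lia.
Qed.

(** Choose multiples (q + h) (n + 1) freely in the coordinates other than [ord0]; the latter takes
    the rest, which is congruent to [m]. Their sum lies between q (n + 1) n and n M, which keeps the
    rest in [k, M). *)
Lemma card_digit_positions (n k m M q K : nat) :
  (n * M + k <= m)%N -> (k <= q * n.+1)%N -> (m < M + q * (n.+1 * n))%N ->
  (forall h, h < K -> (q + h) * n.+1 < M)%N ->
  exists S : {set {ffun 'I_n.+1 -> 'I_M}}, #|S| = (K ^ n)%N /\
    forall f, f \in S -> (\sum_i f i)%N = m /\
      forall i, (k <= f i)%N /\ (f i = (if i == ord0 then m else 0) %[mod n.+1])%N.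
Proof.
move=> Mm kq mM qK.
pose T (h : {ffun 'I_n -> 'I_K}) := (\sum_j (q + h j) * n.+1)%N.
have TM h : (T h <= n * M)%N.
  rewrite -{1}(card_ord n) -sum_nat_const; apply: leq_sum => j _.
  exact: ltnW (qK _ (ltn_ord _)).
have qT h : (q * (n.+1 * n) <= T h)%N.
  rewrite mulnA [leqLHS]mulnC -{1}(card_ord n) -sum_nat_const; apply: leq_sum => j _.
  by rewrite leq_mul2r leq_addr orbT.
pose v (h : {ffun 'I_n -> 'I_K}) (i : 'I_n.+1) :=
   if unlift ord0 i is Some j then ((q + h j) * n.+1)%N else (m - T h)%N.
have vM h i : (v h i < M)%N.
  rewrite /v; case: unliftP => [j _|_]; first exact: qK.
  by have := qT h; have := TM h; lia.
pose phi (h : {ffun 'I_n -> 'I_K}) : {ffun 'I_n.+1 -> 'I_M} := [ffun i => Ordinal (vM h i)].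
have phi_inj : injective phi.
  move=> h h' /ffunP E; apply/ffunP => j; apply/val_inj => /=.
  have /(congr1 val) := E (lift ord0 j); rewrite !ffunE /= /v liftK => /eqP.
  by rewrite eqn_pmul2r// eqn_add2l => /eqP.
exists [set phi h | h in [set: {ffun 'I_n -> 'I_K}]]%SET; split.
  by rewrite card_imset// cardsT card_ffun !card_ord.
move=> _ /imsetP[h _ ->]; split.
  rewrite big_ord_recl ffunE /= {1}/v unlift_none.
  under eq_bigr do rewrite ffunE /= /v liftK.
  by rewrite -/(T h) subnK//; have := TM h; lia.
move=> i; rewrite ffunE /= /v; case: unliftP => [j ->|->]; split.
- by apply: leq_trans kq _; rewrite leq_mul2r leq_addr orbT.
- by rewrite modnMl mod0n.
- by have := TM h; lia.
- have Tm : (T h <= m)%N by have := TM h; lia.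
  by rewrite eqxx -[in RHS](subnK Tm) /T -big_distrl /= addnC modnMDl.
Qed.

(** * Approximation by points with prescribed later digits *)

(** Copy the first [k] digits of [x], read off from the floor [c] of x b^k, and continue with [pat]:
    both numbers lie in the same interval of length b^-k. *)
Lemma exists_digits_near {R : realType} (b k M : nat) (x : R) (pat : nat -> nat) :
  (0 < b)%N -> (forall j, pat j < b)%N -> (k <= M)%N -> 0 <= x -> x < 1 ->
  exists D : nat -> nat, [/\ forall j, (D j < b)%N, forall j, (k <= j)%N -> D j = pat j
    & `|x - cut b D M| < (b ^ k)%:R^-1].
Proof.
move=> b0 patb kM x0 x1.
have bk : 0 < (b ^ k)%:R :> R by rewrite ltr0n expn_gt0 b0.
set c := Num.truncn (x * (b ^ k)%:R).
have /andP[cx xc] : c%:R <= x * (b ^ k)%:R < c.+1%:R by apply: truncn_itv; rewrite mulr_ge0// ltW.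
have cb : (c < b ^ k)%N.
  by rewrite -(ltr_nat R); apply: le_lt_trans cx _; rewrite gtr_pMl.
pose D j := if (j < k)%N then (c %/ b ^ (k - j.+1) %% b)%N else pat j.
have Db j : (D j < b)%N by rewrite /D; case: ifP => // _; rewrite ltn_mod.
have Dk : prefix b D k = c.
  rewrite (prefix_divn b c k) ?subnn ?divn1// => j jk.
  by rewrite /D jk.
exists D; split=> // [j kj|]; first by rewrite /D ltnNge kj.
have lo : c%:R / (b ^ k)%:R <= cut b D M :> R by rewrite -Dk; exact: cut_le.
have hi : cut b D M < c.+1%:R / (b ^ k)%:R :> R by rewrite -Dk; exact: cut_lt_succ.
move: cx xc; rewrite -ler_pdivrMr// -ltr_pdivlMr// => cx xc.
have : c.+1%:R / (b ^ k)%:R = c%:R / (b ^ k)%:R + (b ^ k)%:R^-1 :> R.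
  by rewrite -natr1 mulrDl mul1r.
by rewrite ltr_norml; lra.
Qed.

Lemma euclid_norm_lt {R : realType} (s : nat) (x : 'I_s -> R) (e : R) :
  (0 < s)%N -> (forall i, `|x i| < e) -> euclid_norm x < Num.sqrt s%:R * e.
Proof.
case: s x => // s x _ xe.
have e0 : 0 < e by apply: le_lt_trans (normr_ge0 _) (xe ord0).
rewrite -[X in _ * X](gtr0_norm e0) -sqrtr_sqr -sqrtrM ?ler0n// ltr_sqrt; last first.
  by rewrite mulr_gt0 ?exprn_gt0.
rewrite mulr_natl -[X in _ *+ X]card_ord -sumr_const.
have sq i : x i ^+ 2 < e ^+ 2.
  by rewrite -real_normK ?num_real// ltr_pXn2r// ?nnegrE ?ltW.
rewrite (bigD1 ord0)//= [ltRHS](bigD1 ord0)//=; apply: ltr_leD => //.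
by apply: ler_sum => i _; exact: ltW.
Qed.

(** * The set Gamma and its two properties *)

Theorem theorem4 (R : realType) (b s m : nat) :
  (2 <= b)%N -> (2 <= s)%N -> (2 * s ^ s * (s - 1) ^ s <= m)%N ->
  exists Gamma : set ('I_s -> R),
    (forall g, Gamma g -> in_unit_cube g) /\
    (forall x : 'I_s -> R, in_unit_cube x ->
       exists2 g, Gamma g &
         euclid_norm (fun i => x i - g i) <
           b%:R * Num.sqrt s%:R *
             (1 / (b%:R `^ (m%:R / (2 * (s - 1) * s)%N%:R)))) /\
    (forall P : 'I_(b ^ m) -> ('I_s -> R),
       @is_net R b m s P -> (exists i, Gamma (P i)) ->
       star_disc P >=
         ((b%:R - 1) ^+ s * (2 * s%:R - 3) ^+ (s - 1)) /
           (b%:R ^+ s * (4 * s%:R ^+ 2 * (s%:R - 1) ^+ 2 * ln b%:R) ^+ (s - 1))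
         * (ln (b ^ m)%N%:R ^+ (s - 1) / (b ^ m)%N%:R)).
Proof.
case: s => // -[//|n]; set s := n.+2; rewrite subn1 [s.-1]/=.
move=> b2 _ mbig; have b0 : (0 < b)%N by exact: ltnW.
have msq : (2 * s ^ 2 * n.+1 ^ 2 <= m)%N.
  apply: leq_trans mbig; apply: leq_mul; last by rewrite leq_pexp2l.
  by rewrite leq_mul2l leq_pexp2l.
have := digit_count_bound n.+1 m isT msq => /=; rewrite -/s.
set k := (m %/ _)%N; set M := (_ %/ n.+1)%N; set q := (_ %/ (s * _)).+1.
set K := (_ - q)%N; case=> -[kM Mm] kq mM Kbound.
have qK h : (h < K)%N -> ((q + h) * s < M)%N.
  move=> hK; have : (q + h <= M.-1 %/ s)%N by move: hK; rewrite /K ltn_subRL ltnS.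
  rewrite leq_divRL// => qh; apply: leq_ltn_trans qh _.
  rewrite prednK// lt0n; apply/eqP => M0.
  by move: hK; rewrite /K M0 div0n subSS sub0n.
(* The prescribed residues must sum to [m] for [digit_sum_gap]; [ord0] is the distinguished
   coordinate. *)
pose r (i : 'I_s) := if i == ord0 then m else 0%N.
have rm : (\sum_i r i)%N = m.
  by rewrite (bigD1 ord0)//= /r eqxx big1 ?addn0// => i /negbTE ->.
pose pat i j := if j == r i %[mod s] then b.-1 else 0%N.
have patb i j : (pat i j < b)%N by rewrite /pat; case: ifP => _ //; rewrite prednK.
exists [set g : 'I_s -> R | exists D : 'I_s -> nat -> nat,
  [/\ forall i j, (D i j < b)%N, forall i j, (k <= j)%N -> D i j = pat i j
    & forall i, g i = cut b (D i) M]].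
have inside g : (exists D : 'I_s -> nat -> nat,
  [/\ forall i j, (D i j < b)%N, forall i j, (k <= j)%N -> D i j = pat i j
    & forall i, g i = cut b (D i) M]) -> @in_unit_cube R s g.
  move=> [D [Db _ gD]] i; rewrite gD; split; first by rewrite -(cut0 b (D i)) cut_le.
  have := @cut_lt_succ R b (D i) 0 M b0 (Db i) (leq0n _).
  by rewrite expn0 divr1.
split; [exact: inside|split].
- move=> x xcube.
  have /choice [D DP] : forall i, exists D : nat -> nat, [/\ forall j, (D j < b)%N,
      forall j, (k <= j)%N -> D j = pat i j & `|x i - cut b D M| < (b ^ k)%:R^-1].
    by move=> i; have [x0 x1] := xcube i; exact: exists_digits_near.
  exists (fun i => cut b (D i) M).
    by exists D; split=> // i j; have [] := DP i => // _ Dpat _; exact: Dpat.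
  apply: (@lt_le_trans _ _ (Num.sqrt s%:R * (b ^ k)%:R^-1)).
    by apply: euclid_norm_lt => // i; have [] := DP i.
  rewrite [leRHS]mulrAC [leRHS]mulrC ler_wpM2l ?sqrtr_ge0// mul1r.
  set e := (m%:R / _).
  have bR : 1 <= b%:R :> R by rewrite ler1n.
  have pe : 0 < b%:R `^ e :> R by apply: powR_gt0; rewrite ltr0n.
  (* Since [k] is the floor of [e], the factor [b] in the bound pays for the rounding:
     [e < k + 1]. *)
  rewrite ler_pdivlMr// mulrC ler_pdivrMr ?ltr0n ?expn_gt0 ?b0//.
  rewrite natrX -exprS -powR_mulrn ?ler0n// ler_powR//.
  rewrite ler_pdivrMr ?ltr0n// -natrM ler_nat ltnW// ltn_ceil//.
- move=> P netP [n0 [D [Db Dpat PD]]].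
  have [S [cardS inS]] := card_digit_positions n.+1 k m M q K Mm kq mM qK.
  have disc : local_disc P (fun i => cut b (D i) M)
      <= - (#|S|%:R * ((b%:R - 1) / b%:R) ^+ s).
    apply: (local_disc_le D M n0 S) => // [f fM lo hi|f /inS [fm fk]].
      have [i /andP[kf /negbTE fr]] := digit_sum_gap f r Mm fM rm lo hi.
      by exists i; rewrite Dpat// /pat fr.
    split=> // i; have [kf fr] := fk i.
    by rewrite Dpat// /pat /r fr eqxx.
  have cube : in_unit_cube (fun i => cut b (D i) M : R) by apply: inside; exists D.
  apply: le_trans (le_star_disc P _ cube).
  have N0 : 0 < (b ^ m)%:R :> R by rewrite ltr0n expn_gt0 b0.
  rewrite mulrA ler_pM2r ?invr_gt0//.
  apply: (@le_trans _ _ (#|S|%:R * ((b%:R - 1) / b%:R) ^+ s)); last first.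
    by rewrite -normrN; apply: le_trans (ler_norm _); lra.
  have bR : 1 < b%:R :> R by rewrite ltr1n.
  have lnb : 0 < ln b%:R :> R by rewrite ln_gt0.
  have A0 : 0 < 4 * s%:R ^+ 2 * n.+1%:R ^+ 2 :> R by rewrite !mulr_gt0 ?exprn_gt0 ?ltr0n.
  rewrite cardS (natrX _ b m) (natrX _ K) lnXn ?ltr0n// -[_ *+ m]mulr_natl.
  have -> : s%:R - 1 = n.+1%:R :> R by rewrite /s -natr1 addrK.
  have -> : 2 * s%:R - 3 = (2 * n.+1 - 1)%:R :> R.
    by rewrite natrB ?muln_gt0// /s natrM -natr1; ring.
  rewrite mulrC; set c := (2 * _ - 1)%:R; set A := 4 * _ * _ in A0 *.
  (* The factors [ln b] cancel because ln N = m ln b; what remains is c m / A <= K, which is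
     [Kbound], raised to the power s - 1. *)
  have -> : (m%:R * ln b%:R) ^+ n.+1 *
      ((b%:R - 1) ^+ s * c ^+ n.+1 / (b%:R ^+ s * (A * ln b%:R) ^+ n.+1))
    = (c * m%:R / A) ^+ n.+1 * ((b%:R - 1) / b%:R) ^+ s.
    clearbody A c; have An : A ^+ n.+1 != 0 by rewrite expf_neq0 ?gt_eqF.
    have Ln : ln b%:R ^+ n.+1 != 0 :> R by rewrite expf_neq0 ?gt_eqF.
    have bn : b%:R ^+ s != 0 :> R by rewrite expf_neq0 ?gt_eqF ?ltr0n.
    rewrite !exprMn !exprVn; move: (A ^+ _) (ln _ ^+ _) (b%:R ^+ s) An Ln bn => ? ? ? *.
    move: (_ ^+ s) (c ^+ _) (m%:R ^+ _) => ? ? ?.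
    by field; apply/and3P.
  rewrite ler_wpM2r//.
    by apply/exprn_ge0/divr_ge0; rewrite ?ler0n// subr_ge0 ltW.
  apply: lerXn2r; rewrite ?nnegrE ?ler0n//.
    by apply: divr_ge0; [rewrite mulr_ge0 ?ler0n|exact: ltW].
  by rewrite ler_pdivrMr// [leRHS]mulrC /A -(natrX _ s) -(natrX _ n.+1) -!natrM ler_nat.
Qed.
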